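(* Let $G$ be a finite group and $N$ a normal subgroup of $G$. Write $\operatorname{rdim}(G)=n$. Then $$\operatorname{rdim}(G/N)\leq n\,j(n),$$ where $j$ is any bounding function in Jordan's theorem.
   Context: For a finite group $G$, $\operatorname{rdim}(G)$ is the smallest integer $n$ such that $G$ embeds into $\operatorname{GL}(n,\mathbb{C})$. A bounding function in Jordan's theorem is an integer-valued function $j$ such that, for every $n$, every finite group $H$ that embeds into $\operatorname{GL}(n,\mathbb{C})$ has an abelian normal subgroup $A\trianglelefteq H$ with $|H:A|\leq j(n)$. *)

(* Defs.v *)
From mathcomp Require Import all_boot all_order all_algebra all_fingroup.
From mathcomp Require Import all_character.
From mathcomp Require Import boolp reals.
From mathcomp Require Import complex.

Set Implicit Arguments.
Unset Strict Implicit.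
Unset Printing Implicit Defensive.

Local Open Scope group_scope.

(* For R : realType, the field R[i] is the field of complex numbers.          *)
(* A homomorphism from G to GL(n, R[i]) is a matrix representation of G of    *)
(* degree n, and it is injective iff its kernel is trivial (mx_faithful).     *)
(* The degree n = 0 is allowed and GL(0, R[i]) is the trivial group, so the   *)
(* trivial group has rdim 0.                                                  *)
Definition embeds_GL (R : realType) (gT : finGroupType) (G : {group gT})
    (n : nat) : Prop :=
  exists rG : mx_representation R[i] G n, mx_faithful rG.

Lemma embeds_GL_regular (R : realType) (gT : finGroupType) (G : {group gT}) :
  embeds_GL R G #|G|.
Proof. by exists (regular_repr R[i] G); apply: regular_mx_faithful. Qed.

Lemma rdim_subproof (R : realType) (gT : finGroupType) (G : {group gT}) :
  exists n, `[< embeds_GL R G n >].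
Proof. by exists #|G|; apply/asboolP; apply: embeds_GL_regular. Qed.

Definition rdim (R : realType) (gT : finGroupType) (G : {group gT}) : nat :=
  ex_minn (rdim_subproof R G).

Definition Jordan_bound (R : realType) (j : nat -> int) : Prop :=
  forall (n : nat) (hT : finGroupType) (H : {group hT}),
    embeds_GL R H n ->
    exists A : {group hT},
      [/\ A <| H, abelian A & (#|H : A|%:Z <= j n)%R].

(* Main.v *)
(* An abelian A <| G with |G : A| <= j n has rank at most n, because an
   elementary abelian p-subgroup of GL(n, C) is diagonalizable, hence has order
   at most p ^ n.  The quotient B = AN/N then has rank at most n too, so it has
   n linear characters l with trivial common kernel.  The elements
   \sum_(b in B) l(b)^-1 b generate a faithful submodule of the regular
   representation of G/N, of dimension at most n * |G/N : B|. *)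
Require Import Defs.
From mathcomp Require Import all_boot all_order all_algebra all_fingroup.
From mathcomp Require Import all_solvable all_field all_character.
From mathcomp Require Import boolp reals.
From mathcomp Require Import complex.

Set Implicit Arguments.
Unset Strict Implicit.
Unset Printing Implicit Defensive.

Import Order.TTheory GRing.Theory Num.Theory.

Local Open Scope ring_scope.

(** * Roots of unity and the rank of abelian linear groups *)

Lemma prim_root_exists (C : numClosedFieldType) n :
  (n > 0)%N -> exists z : C, n.-primitive_root z.
Proof.
pose p : {poly C} := 'X^n - 1; have [r Dp] := closed_field_poly_normal p.
move=> n_gt0; rewrite (monicP _) ?monicXnsubC // scale1r in Dp.
have rn1: all n.-unity_root r by apply/allP=> z; rewrite -root_prod_XsubC -Dp.
have sz_r: (n < (size r).+1)%N.
  by rewrite -(size_prod_XsubC r id) -Dp size_XnsubC.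
have [|z] := hasP (has_prim_root n_gt0 rn1 _ sz_r); last by exists z.
by rewrite -separable_prod_XsubC -Dp separable_Xn_sub_1 // pnatr_eq0 -lt0n.
Qed.

(** The minimal polynomial divides ['X^m - 1], which splits with distinct roots in characteristic
    0. *)
Lemma diagonalizable_expr1 (C : numClosedFieldType) n m (A : 'M[C]_n.+1) :
  (m > 0)%N -> A ^+ m = 1 -> diagonalizable A.
Proof.
move=> m_gt0 Am1; have [z prim_z] := prim_root_exists C m_gt0.
apply/diagonalizableP; exists [seq z ^+ i | i <- index_iota 0 m].
  rewrite -separable_prod_XsubC big_map (factor_Xn_sub_1 prim_z).
  by rewrite separable_Xn_sub_1 // pnatr_eq0 -lt0n.
rewrite big_map (factor_Xn_sub_1 prim_z); apply: mxminpoly_min.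
by rewrite rmorphB rmorphXn /= horner_mx_X rmorph1 Am1 subrr.
Qed.

Lemma faithful_degree0 (F : fieldType) (gT : finGroupType) (G : {group gT})
    (rG : mx_representation F G 0) : mx_faithful rG -> G :=: 1%g.
Proof.
move=> injG; apply/trivgP/subsetP=> x Gx; rewrite inE.
by apply/eqP/(mx_faithful_inj injG) => //; rewrite [LHS]flatmx0 [RHS]flatmx0.
Qed.

(** The commuting matrices [rE x] are diagonalized simultaneously. Their eigenvalues are p-th roots
    of unity, so [x] is determined by [n] exponents modulo [p]. *)
Lemma abelem_faithful_card (C : numClosedFieldType) (gT : finGroupType)
    (E : {group gT}) p n (rE : mx_representation C E n) :
  prime p -> (p.-abelem E)%g -> mx_faithful rE -> (#|E| <= p ^ n)%N.
Proof.
case: n rE => [|n] rE p_pr abelE injE.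
  by rewrite (faithful_degree0 injE) cards1.
have [cEE expE] := abelemP p_pr abelE.
have [z prim_z] := prim_root_exists C (prime_gt0 p_pr).
have rEp x : x \in E -> rE x ^+ p = 1.
  by move=> Ex; rewrite -repr_mxX // expE // repr_mx1.
have [P P_unit /allP/= diagP] :
    codiagonalizable [seq rE x | x <- enum E].
  apply/codiagonalizableP; split=> [f g|f] /mapP[x].
    rewrite mem_enum => Ex -> /mapP[y]; rewrite mem_enum => Ey ->.
    by rewrite /comm_mx -!repr_mxM // (centsP cEE x).
  rewrite mem_enum => Ex ->.
  exact: diagonalizable_expr1 (prime_gt0 p_pr) (rEp x Ex).
(* The diagonals are gathered into one total function [d]; its value 0 outside [E] is a dummy. *)
have /fin_all_exists[d dP] x :
    exists d : 'rV_n.+1, x \in E -> P *m rE x = diag_mx d *m P.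
  case Ex: (x \in E); last by exists 0.
  have /similar_diagPex[d /similarP dx] : similar_diag P (rE x).
    by apply: diagP; apply: map_f; rewrite mem_enum.
  by exists d => _; apply: dx.
have dX x : x \in E -> forall i, d x 0 i ^+ p = 1.
  move=> Ex i; have diagE : diag_mx (d x) = P * rE x / P.
    by apply: (canRL (mulrK P_unit)); apply/esym/dP.
  have: (diag_mx (d x)) ^+ p = 1.
    have -> k : diag_mx (d x) ^+ k = P * rE x ^+ k / P.
      elim: k => [|k IHk]; first by rewrite !expr0 mulr1 divrr.
      by rewrite exprSr IHk diagE exprSr !mulrA mulrVK.
    by rewrite rEp // mulr1 divrr.
  have -> k : diag_mx (d x) ^+ k = diag_mx (\row_j d x 0 j ^+ k).
    elim: k => [|k IHk].
      by apply/matrixP=> a b; rewrite !mxE expr0.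
    rewrite exprSr IHk -[_ * _]/(_ *m _) mulmx_diag.
    by congr diag_mx; apply/rowP=> j; rewrite !mxE exprSr.
  by move=> /matrixP/(_ i i); rewrite !mxE eqxx.
(* [phi x] lists the exponents of the eigenvalues of [rE x] as powers of [z]; there are [p ^ n.+1]
   such lists. *)
have /fin_all_exists[phi phiP] x :
    exists f : {ffun 'I_n.+1 -> 'I_p},
      x \in E -> forall i, d x 0 i = z ^+ f i.
  case Ex: (x \in E); last first.
    by exists [ffun => Ordinal (prime_gt0 p_pr)].
  exists [ffun i => sval (prim_rootP prim_z (dX x Ex i))] => _ i.
  by rewrite ffunE; case: prim_rootP.
have inj_phi : {in E &, injective phi}.
  move=> x y Ex Ey eq_phi; apply: (mx_faithful_inj injE) => //.
  apply: (can_inj (mulKmx P_unit)); rewrite !dP //; congr (diag_mx _ *m _).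
  by apply/rowP=> i; rewrite !phiP ?eq_phi.
rewrite -(card_in_imset inj_phi) (leq_trans (max_card _)) //.
by rewrite card_ffun !card_ord.
Qed.

(** The rank r is attained by an elementary abelian p-subgroup of order p^r, on which the restricted
    representation stays faithful; hence p^r is at most p^n. *)
Lemma rank_le_faithful_degree (C : numClosedFieldType) (gT : finGroupType)
    (A : {group gT}) n (rA : mx_representation C A n) :
  mx_faithful rA -> ('r(A)%g <= n)%N.
Proof.
move=> injA; have [p p_pr ->] := rank_witness A.
have [E /pnElemP[sEA abelE <-]] := p_rank_witness p A.
have := abelem_faithful_card p_pr abelE (subg_mx_faithful sEA injA).
by rewrite {1}(card_pgroup (abelem_pgroup abelE)) leq_exp2l ?prime_gt1.
Qed.

(** * Linear characters with trivial common kernel *)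

Definition separating_chars (C : fieldType) (gT : finGroupType)
    (B : {group gT}) n (l : 'I_n -> gT -> C) :=
  [/\ forall i, l i 1%g = 1,
      forall i, {in B &, {morph l i : x y / (x * y)%g >-> x * y}}
    & {in B, forall x, (forall i, l i x = 1) -> x = 1%g}].

Lemma cycle_faithful_char (C : numClosedFieldType) (gT : finGroupType)
    (x : gT) :
  exists l : gT -> C, [/\ l 1%g = 1,
    {in <[x]>%g &, {morph l : y z / (y * z)%g >-> y * z}}
    & {in <[x]>%g, forall y, l y = 1 -> y = 1%g}].
Proof.
have [z prim_z] := prim_root_exists C (order_gt0 x).
(* The character sends [x ^+ k] to [z ^+ k]; the value 1 outside the cycle is a filler. *)
pose l y := if [pick k : 'I_#[x]%g | (x ^+ k)%g == y] is Some k
            then z ^+ k else 1.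
have lX k : l (x ^+ k)%g = z ^+ k.
  rewrite /l; case: pickP => [j|/(_ (Ordinal (ltn_pmod k (order_gt0 x))))].
    by rewrite eq_expg_mod_order -(eq_prim_root_expr prim_z) => /eqP.
  by rewrite /= expg_mod_order eqxx.
exists l; split; first by rewrite -(expg0 x) lX expr0.
  by move=> _ _ /cycleP[i ->] /cycleP[j ->]; rewrite -expgD !lX exprD.
move=> _ /cycleP[i ->]; rewrite lX => /eqP.
by rewrite -(prim_order_dvd prim_z) order_dvdn => /eqP.
Qed.

(** Induction on the number of cyclic factors: the characters of the first factor and of the
    remaining product [H] are pulled back along the two projections. *)
Lemma dprod_cycles_separating_chars (C : numClosedFieldType)
    (gT : finGroupType) (b : seq gT) (B : {group gT}) :
  (\big[dprod/1]_(x <- b) <[x]>)%g = B ->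
  exists l : 'I_(size b) -> gT -> C, separating_chars B l.
Proof.
elim: b B => [|x b IHb] B.
  rewrite big_nil => defB; exists (fun _ _ => 1); split=> //.
    by move=> _ y z _ _; rewrite mulr1.
  by move=> y; rewrite -defB => /set1P.
rewrite big_cons => dprodB; have [nsxB _] := dprod_normal2 dprodB.
have [[_ H _ defH] defB cKH tiKH] := dprodP dprodB.
have [l [l1 lM l_inj]] := IHb H defH; rewrite defH in defB cKH tiKH.
have [l0 [l01 l0M l0_inj]] := cycle_faithful_char C x.
(* The projections to [<[x]>] and [H] are [divgr] and [remgr]; they are multiplicative on [B] since
   the factors are complements and commute. *)
have compH : H \in [complements to <[x]> in B]%g by apply/complP.
have divP y : y \in B -> divgr <[x]> H y \in <[x]>%g.
  by rewrite -defB; apply: mem_divgr.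
have remP y : y \in B -> remgr <[x]> H y \in H.
  by rewrite -defB; apply: mem_remgr.
pose m i y := if unlift ord0 i is Some j then l j (remgr <[x]> H y)
              else l0 (divgr <[x]> H y).
exists m; split=> [i|i y z By Bz|y By m1].
- by rewrite /m divgr_id // remgr1 //; case: unliftP => [j|] _.
- rewrite /m (remgrM compH) // (divgrM compH) //.
  by case: unliftP => [j|] _; rewrite (lM, l0M) ?remP ?divP.
rewrite (divgr_eq <[x]>%g H y).
have := m1 ord0; rewrite /m unlift_none => /l0_inj -> //; last exact: divP.
rewrite mul1g; apply: l_inj => [|j]; first exact: remP.
by have := m1 (lift ord0 j); rewrite /m liftK.
Qed.

Lemma abelian_separating_chars (C : numClosedFieldType)
    (gT : finGroupType) (B : {group gT}) n :
  abelian B -> ('r(B)%g <= n)%N ->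
  exists l : 'I_n -> gT -> C, separating_chars B l.
Proof.
move=> abB; have [b dprodB orderb] := abelian_structure abB.
rewrite -size_abelian_type // -orderb size_map => le_b_n.
have [l [l1 lM l_inj]] := dprod_cycles_separating_chars C dprodB.
(* The number of cyclic factors equals the rank; indices from [size b] on get the trivial
   character. *)
exists (fun i x => oapp (l^~ x) 1 (insub (val i))); split.
- by move=> i; case: insubP => //= j.
- by move=> i x y Bx By; case: insubP => [j _ _|_] /=; rewrite ?lM ?mulr1.
move=> x Bx lx; apply: l_inj => // j.
by have := lx (widen_ord le_b_n j); rewrite /= valK.
Qed.

(** * A small faithful submodule of the regular representation *)

(** [B] acts on the line of [e i] through [l i], so up to a scalar the translate of [e i] by [h]
    depends only on the coset [B :* h]. This bounds the dimension; faithfulness follows by comparing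
    coefficients at [h]. *)
Lemma induced_faithful_rep (F : fieldType) (gT : finGroupType)
    (H B : {group gT}) n (l : 'I_n -> gT -> F) :
  (n > 0)%N -> B \subset H -> separating_chars B l ->
  exists m (rH : mx_representation F H m),
    mx_faithful rH /\ (m <= n * #|H : B|%g)%N.
Proof.
move=> n_gt0 sBH [l1 lM l_inj]; pose aH := regular_repr F H.
pose e i := gring_row (\sum_(b in B) l i b^-1%g *: aH b).
have eB i b : b \in B -> e i *m aH b = l i b *: e i.
  move=> Bb; rewrite -gring_row_mul -linearZ /=; congr gring_row.
  rewrite mulmx_suml scaler_sumr (reindex_inj (mulIg b^-1%g)) /=.
  apply: eq_big => [c|c Bc]; first by rewrite groupMr ?groupV.
  have Hb := subsetP sBH b Bb.
  rewrite -scalemxAl scalerA invMg invgK lM ?groupV //; last first.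
    by move: Bc; rewrite groupMr ?groupV.
  have Hc : c \in H by apply: (subsetP sBH); rewrite -(groupMr _ (groupVr Bb)).
  by rewrite -repr_mxM ?mulgKV // groupMr ?groupV.
pose v (k : 'I_n * {set gT}) := e k.1 *m aH (repr k.2).
pose U := (\sum_(k | k.2 \in rcosets B H) <<v k>>)%MS.
have eU i h : h \in H -> (e i *m aH h <= U)%MS.
  move=> Hh; apply: (@submx_trans _ _ _ _ _ _ (v (i, (B :* h)%g))).
    have -> : v (i, (B :* h)%g) = e i *m aH (repr (B :* h)%g) by [].
    case: repr_rcosetP => b Bb.
    have Hb := subsetP sBH b Bb.
    rewrite repr_mxM // mulmxA (eB i b) // -scalemxAl -[X in (X <= _)%MS]scale1r.
    (* Another coset representative only multiplies the vector by [l i b], which is invertible. *)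
    have lb : l i b^-1%g * l i b = 1 by rewrite -lM ?groupV // mulVg.
    by rewrite -lb -scalerA scalemx_sub.
  by rewrite (sumsmx_sup (i, (B :* h)%g)) ?genmxE //= mem_rcosets mulSGid.
have Umod : mxmodule aH U.
  apply/mxmoduleP=> h Hh; rewrite sumsmxMr; apply/sumsmx_subP=> k.
  case/rcosetsP=> g Hg def_k; rewrite (eqmxMr _ (genmxE _)) /v def_k.
  have Hr : repr (B :* g)%g \in H.
    by case: repr_rcosetP => b /(subsetP sBH) Hb; rewrite groupM.
  by rewrite -mulmxA -repr_mxM // eU // groupM.
exists (\rank U), (submod_repr Umod); split; last first.
  apply: leq_trans (mxrank_sum_leqif _).1 _ => /=.
  apply: (@leq_trans (\sum_(k : 'I_n * {set gT} | k.2 \in rcosets B H) 1)).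
    by apply: leq_sum => k _; rewrite mxrank_gen rank_leq_row.
  rewrite sum1dep_card /=.
  have <- : #|setX [set: 'I_n] (rcosets B H)| = (n * #|H : B|%g)%N.
    by rewrite cardsX cardsT card_ord.
  by apply: subset_leq_card; apply/subsetP=> k; rewrite !inE.
rewrite /mx_faithful rker_submod; apply/subsetP=> h /setIdP[Hh /eqP Uh].
have eh i : e i *m aH h = e i.
  have /submxP[D ->] : (e i <= U)%MS by rewrite -[e i]mulmx1 -(repr_mx1 aH) eU.
  by rewrite -mulmxA Uh.
(* Since [h] fixes [e i], its coefficient at [h] is that of the translate by [h], to which only
   [b = 1] contributes. *)
have coef i : gring_proj h (\sum_(b in B) l i b^-1%g *: aH b) = 1%:M.
  rewrite /gring_proj /= -/(e i) -(eh i) -gring_row_mul.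
  rewrite -[LHS]/(gring_proj h _) mulmx_suml linear_sum (bigD1 1%g) //=.
  rewrite -scalemxAl -repr_mxM // linearZ /= gring_projE ?mul1g // eqxx.
  rewrite invg1 l1 scale1r big1 ?addr0 // => b /andP[/(subsetP sBH) Hb nb1].
  rewrite -scalemxAl -repr_mxM // linearZ /= gring_projE ?groupM //.
  by rewrite -{1}[h]mul1g (inj_eq (mulIg h)) eq_sym (negPf nb1) scaler0.
(* The same coefficient, now read off directly from the sum. *)
have coefE i : gring_proj h (\sum_(b in B) l i b^-1%g *: aH b)
    = (if h \in B then l i h^-1%g else 0)%:M.
  rewrite linear_sum; case: ifPn => [Bh|nBh].
    rewrite (bigD1 h) //= linearZ /= gring_projE // eqxx big1 ?addr0 => [|b].
      by rewrite -mul_scalar_mx mulmx1.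
    case/andP=> /(subsetP sBH) Hb nbh; rewrite linearZ /= gring_projE //.
    by rewrite eq_sym (negPf nbh) scaler0.
  rewrite big1 ?raddf0 // => b Bb.
  rewrite linearZ /= gring_projE // ?(subsetP sBH b Bb) //.
  by case: eqP nBh => [->|]; rewrite ?Bb ?scaler0.
have lh : forall i, (if h \in B then l i h^-1%g else 0) = 1.
  by move=> i; have /matrixP/(_ 0 0) := coefE i; rewrite coef !mxE.
(* As [n > 0] there is an index to test; for [h] outside [B] it would give 0 = 1. *)
have Bh : h \in B.
  have := lh (Ordinal n_gt0); case: ifP => // _ /eqP.
  by rewrite eq_sym oner_eq0.
have hV1 : h^-1%g = 1%g.
  by apply: l_inj => [|i]; [rewrite groupV | have := lh i; rewrite Bh].
by rewrite inE -eq_invg1 hV1.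
Qed.

(** * Bounds on [rdim] and the quotient theorem *)

Lemma rdim_le (R : realType) (gT : finGroupType) (G : {group gT}) n :
  embeds_GL R G n -> (rdim R G <= n)%N.
Proof.
by rewrite /rdim => embG; case: ex_minnP => m _; apply; apply/asboolP.
Qed.

Lemma embeds_GL_rdim (R : realType) (gT : finGroupType) (G : {group gT}) :
  embeds_GL R G (rdim R G).
Proof. by rewrite /rdim; case: ex_minnP => m /asboolP. Qed.

Lemma rdim_trivg (R : realType) (gT : finGroupType) (G : {group gT}) :
  G :=: 1%g -> rdim R G = 0%N.
Proof.
move=> G1; apply/eqP; rewrite -leqn0; apply: rdim_le.
have rP : mx_repr G (fun=> 1%:M : 'M[R[i]]_0).
  by split=> // x y _ _; rewrite mulmx1.
exists (MxRepresentation rP); apply/subsetP=> x /setIdP[].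
by rewrite {1}G1.
Qed.

Lemma rdim_abelian_index (R : realType) (gT : finGroupType)
    (H B : {group gT}) n :
  (n > 0)%N -> B \subset H -> abelian B -> ('r(B)%g <= n)%N ->
  (rdim R H <= n * #|H : B|%g)%N.
Proof.
move=> n_gt0 sBH abB rB.
have [l sepl] := abelian_separating_chars R[i] abB rB.
have [m [rH [injH le_m]]] := induced_faithful_rep n_gt0 sBH sepl.
by apply: leq_trans le_m; apply: rdim_le; exists rH.
Qed.

Theorem theoremE (R : realType) (j : nat -> int) (gT : finGroupType)
    (G N : {group gT}) (n : nat) :
  Jordan_bound R j -> (N <| G)%g -> rdim R G = n ->
  ((rdim R (G / N)%G)%:Z <= n%:Z * j n)%R.
Proof.
move=> jP nsNG defn; have := embeds_GL_rdim R G; rewrite defn => embG.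
have [A [nsAG abA indexA]] := jP n gT G embG.
have [rG injG] := embG.
have sAG := normal_sub nsAG.
have rA : ('r(A)%g <= n)%N.
  exact: rank_le_faithful_degree (subg_mx_faithful sAG injG).
(* Commutativity of [A] matters here: the rank of a general group can grow in a quotient. *)
have rB : ('r((A / N)%G)%g <= n)%N.
  exact: leq_trans (quotient_rank_abelian _ abA) rA.
(* For [n = 0] the group [G] is trivial and both sides vanish; the induced module needs at least one
   character. *)
have [n0 | n_gt0] := posnP n.
  rewrite n0 mul0r rdim_trivg //=; move: rG injG; rewrite n0 => rG injG.
  by rewrite (faithful_degree0 injG) quotient1.
apply: (@le_trans _ _ (n%:Z * #|G : A|%g%:Z)); last exact: ler_wpM2l.
rewrite -PoszM lez_nat.
have sBH := quotientS N sAG.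
have abB := quotient_abelian N abA.
apply: leq_trans (rdim_abelian_index R n_gt0 sBH abB rB) _.
(* The index of [A / N] in [G / N] divides that of [A] in [G]. *)
rewrite leq_mul2l dvdn_leq ?orbT // index_quotient //.
by rewrite subIset // normal_norm.
Qed.
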